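(* The inconsistency index $K$ is upper bounded: for all $m\ge 2$, all pairwise comparison matrices $\mathbf{A}_1,\ldots,\mathbf{A}_m\in\mathcal{A}$ of the same order and all $\boldsymbol{\lambda}\in\mathcal{L}_m$, $$K(\mathbf{A}^{\star})\le \max\{K(\mathbf{A}_1),\ldots,K(\mathbf{A}_m)\}.$$
   Context: A pairwise comparison matrix of order $n$ is a real $n\times n$ matrix $\mathbf{A}=(a_{ij})$ with $a_{ij}>0$ and $a_{ij}a_{ji}=1$ for all $i,j$. $\mathcal{A}$ is the set of all pairwise comparison matrices of all orders $n>2$. $\mathcal{L}_m=\{(\lambda_1,\ldots,\lambda_m): \lambda_h\ge 0\ \forall h,\ \sum_{h=1}^m\lambda_h=1\}$. Given $\mathbf{A}_h=(a_{ij}^{(h)})_{n\times n}\in\mathcal{A}$, $h=1,\ldots,m$ (same order $n$), and $\boldsymbol{\lambda}\in\mathcal{L}_m$, the aggregated matrix $\mathbf{A}^{\star}=(a_{ij}^{\star})_{n\times n}$ is $a_{ij}^{\star}=\prod_{h=1}^m (a_{ij}^{(h)})^{\lambda_h}$. For $\mathbf{A}\in\mathcal{A}$ of order $n$, $$K(\mathbf{A})=\max_{1\le i<j<k\le n}\ \min\left\{\left|1-a_{ij}a_{jk}a_{ki}\right|,\ \left|1-\frac{1}{a_{ij}a_{jk}a_{ki}}\right|\right\}.$$ *)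

(* Defs.v *)
From HB Require Import structures.
From mathcomp Require Import all_boot all_order all_algebra.
From mathcomp Require Import reals exp.

Set Implicit Arguments.
Unset Strict Implicit.
Unset Printing Implicit Defensive.

Import Order.TTheory GRing.Theory Num.Theory.
Local Open Scope ring_scope.

Definition pairwise_comparison (R : realType) (n : nat) (A : 'M[R]_n) : Prop :=
  forall i j : 'I_n, 0 < A i j /\ A i j * A j i = 1.

Definition in_pcm (R : realType) (n : nat) (A : 'M[R]_n) : Prop :=
  (2 < n)%N /\ pairwise_comparison A.

Definition weight_vector (R : realType) (m : nat) (lambda : 'I_m -> R) : Prop :=
  (forall h : 'I_m, 0 <= lambda h) /\ \sum_(h < m) lambda h = 1.

Definition aggregate (R : realType) (m n : nat)
    (A : 'I_m -> 'M[R]_n) (lambda : 'I_m -> R) : 'M[R]_n :=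
  \matrix_(i, j) \prod_(h < m) (A h i j `^ lambda h).

Definition triad_inconsistency (R : realType) (n : nat) (A : 'M[R]_n)
    (i j k : 'I_n) : R :=
  Num.min `|1 - A i j * A j k * A k i| `|1 - 1 / (A i j * A j k * A k i)|.

(* The default value 0 of the iterated maxima never matters: the terms are
   nonnegative, and for n > 2 there is at least one triple i < j < k. *)
Definition K (R : realType) (n : nat) (A : 'M[R]_n) : R :=
  \big[Num.max/0]_(i < n) \big[Num.max/0]_(j < n | (i < j)%N)
    \big[Num.max/0]_(k < n | (j < k)%N) triad_inconsistency A i j k.

(* Main.v *)
(* For x > 0, min(|1 - x|, |1 - 1/x|) = 1 - min(x, 1/x); hence a bound M on the
   inconsistency of a triad with product x says exactly that 1 - M <= x and
   1 - M <= 1/x. Both x and 1/x for the aggregated matrix are weighted geometric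
   means of the corresponding values for the given matrices, and lower bounds
   pass to weighted geometric means. *)
Require Import Defs.
From HB Require Import structures.
From mathcomp Require Import all_boot all_order all_algebra.
From mathcomp Require Import reals exp.

Set Implicit Arguments.
Unset Strict Implicit.
Unset Printing Implicit Defensive.

Import Order.TTheory GRing.Theory Num.Theory.
Local Open Scope ring_scope.

(** Both sides are invariant under exchanging [x] and [x^-1], so [x <= 1] may be assumed. Then
    [x^-1 - 1 = x^-1 * (1 - x)] is at least [1 - x], since [x^-1 >= 1]. *)
Lemma min_dist1_inv (R : realFieldType) (x : R) : 0 < x ->
  Num.min `|1 - x| `|1 - 1 / x| = 1 - Num.min x x^-1.
Proof.
wlog x1 : x / x <= 1 => [wl x0|x0].
  have [x1|x1] := leP x 1; first exact: wl.
  have := wl x^-1; rewrite !div1r invrK invf_le1 // (ltW x1) invr_gt0 x0.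
  by rewrite minC (minC x); exact.
have xV1 : 1 <= x^-1 by rewrite invf_ge1.
rewrite div1r (min_l (le_trans x1 xV1)) ger0_norm ?subr_ge0 //.
rewrite ler0_norm ?subr_le0 // opprB min_l //.
have -> : x^-1 - 1 = x^-1 * (1 - x) by rewrite mulrBr mulr1 mulVf ?gt_eqF.
by rewrite ler_peMl ?subr_ge0.
Qed.

Lemma min_dist1_inv_le (R : realFieldType) (x M : R) : 0 < x ->
  (Num.min `|1 - x| `|1 - 1 / x| <= M) = (1 - M <= x) && (1 - M <= x^-1).
Proof. by move=> x0; rewrite min_dist1_inv // lerBlDl -lerBlDr le_min. Qed.

Lemma powR_sumr (R : realType) (I : finType) (c : R) (w : I -> R) : 0 < c ->
  c `^ (\sum_i w i) = \prod_i c `^ w i.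
Proof.
move=> c0; apply: (big_morph (powR c)); last exact: powRr0.
by move=> a b; rewrite powRD // (gt_eqF c0) implybT.
Qed.

Lemma prod_powR_gt0 (R : realType) (m : nat) (w x : 'I_m -> R) :
  (forall h, 0 < x h) -> 0 < \prod_h x h `^ w h.
Proof. by move=> x0; apply: prodr_gt0 => h _; exact: powR_gt0. Qed.

Lemma le_prod_powR (R : realType) (m : nat) (w x : 'I_m -> R) (c : R) :
  weight_vector w -> (forall h, 0 < x h) -> (forall h, c <= x h) ->
  c <= \prod_h x h `^ w h.
Proof.
(* The case [c <= 0] does occur: the bound used later is [1 - M], and [M] may exceed 1. *)
move=> [w0 w1] x0 cx; have [c0|c0] := leP c 0.
  by rewrite (le_trans c0) // ltW // prod_powR_gt0.
(* As the weights sum to 1, [c] is its own weighted geometric mean, and the comparison is made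
   factor by factor. *)
rewrite -[leLHS](powRr1 (ltW c0)) -[X in c `^ X]w1 powR_sumr //.
apply: ler_prod => h _; rewrite powR_ge0 /=.
by rewrite ge0_ler_powR // nnegrE ltW.
Qed.

Lemma prod_powRM (R : realType) (m : nat) (w x y : 'I_m -> R) :
  (forall h, 0 < x h) -> (forall h, 0 < y h) ->
  (\prod_h x h `^ w h) * (\prod_h y h `^ w h) = \prod_h (x h * y h) `^ w h.
Proof.
by move=> x0 y0; rewrite -big_split; apply: eq_bigr => h _; rewrite powRM ?ltW.
Qed.

Lemma prod_powRV (R : realType) (m : nat) (w x : 'I_m -> R) :
  (forall h, 0 < x h) ->
  (\prod_h x h `^ w h)^-1 = \prod_h (x h)^-1 `^ w h.
Proof.
move=> x0; rewrite -prodfV; apply: eq_bigr => h _.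
by rewrite -[LHS]powR_inv1 ?powR_ge0 // powRAC powR_inv1 ?ltW.
Qed.

Lemma triad_le_K (R : realType) (n : nat) (A : 'M[R]_n) (i j k : 'I_n) :
  (i < j)%N -> (j < k)%N -> triad_inconsistency A i j k <= K A.
Proof.
move=> ij jk; apply: (bigmax_sup i) => //.
by apply: (bigmax_sup j) => //; apply: (bigmax_sup k).
Qed.

Theorem proposition6 (R : realType) (m n : nat) (hm : (2 <= m)%N)
  (A : 'I_m -> 'M[R]_n) (hA : forall h : 'I_m, in_pcm (A h))
  (lambda : 'I_m -> R) (hlambda : weight_vector lambda) :
  K (aggregate A lambda) <= \big[Num.max/0]_(h < m) K (A h).
Proof.
(* [M0] covers the default value 0 of the three nested maxima in [K]. *)
set M := \big[_/_]_(_ < m) _; have M0 : 0 <= M by exact: bigmax_ge_id.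
apply: bigmax_le => // i _; apply: bigmax_le => // j ij.
apply: bigmax_le => // k jk.
have A0 h a b : 0 < A h a b by have [_ /(_ a b)[]] := hA h.
pose x h := A h i j * A h j k * A h k i.
have x0 h : 0 < x h by rewrite !mulr_gt0.
have xM h : (1 - M <= x h) && (1 - M <= (x h)^-1).
  rewrite -min_dist1_inv_le //; apply: le_trans (triad_le_K (A h) ij jk) _.
  exact: (bigmax_sup h).
(* The three aggregated entries multiply to the weighted geometric mean of the triad products
   [x h]. *)
rewrite /triad_inconsistency !mxE !prod_powRM //; last first.
  by move=> h; rewrite mulr_gt0.
rewrite min_dist1_inv_le ?prod_powR_gt0 // prod_powRV //.
apply/andP; split; apply: le_prod_powR => // h.
- by have /andP[] := xM h.
- by rewrite invr_gt0; exact: x0.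
- by have /andP[] := xM h.
Qed.
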